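(* For any positive integers $m,n,s$ with $s\ge 3$ and $n-1\le m\le \binom{n}{2}$, $$\max\{k_s(G) : G\in\mathscr{G}_{m,n}\}=\binom{r_{m,n}}{s}+\binom{t_{m,n}}{s-1}.$$
   Context: Graphs are undirected, finite and simple. $\mathscr{G}_{m,n}$ is the set of connected graphs with $m$ edges and $n$ vertices. $k_s(G)$ is the number of $s$-cliques of $G$, i.e. the number of complete subgraphs of $G$ on $s$ vertices. Binomial coefficients $\binom{a}{b}$ with $0\le a<b$ are $0$. For positive integers $m,n$ with $n-1\le m\le\binom n2$, the positive integers $r_{m,n}$ and $t_{m,n}$ are defined by $$m-n=\binom{r_{m,n}-1}{2}+t_{m,n}-2,$$ where $2\le t_{m,n}\le r_{m,n}$ if $m-n\ge 0$, and $t_{m,n}=r_{m,n}=1$ if $m-n=-1$ (this determines them uniquely). *)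

(* Defs.v *)
From HB Require Import structures.
From mathcomp Require Import all_boot all_order all_algebra.
From mathcomp Require Import zify.

Set Implicit Arguments.
Unset Strict Implicit.
Unset Printing Implicit Defensive.

Record sgraph := SGraph {
  svertex :> finType;
  sadj : rel svertex;
  sadj_sym : symmetric sadj;
  sadj_irrefl : irreflexive sadj
}.

Definition edges (G : sgraph) : {set {set G}} :=
  [set e | [exists x : G, exists y : G, sadj x y && (e == [set x; y])]].

Definition connected_graph (G : sgraph) : Prop :=
  forall x y : G, connect (@sadj G) x y.

Definition clique (G : sgraph) (A : {set G}) : bool :=
  [forall x in A, forall y in A, (x != y) ==> sadj x y].

Definition num_cliques (s : nat) (G : sgraph) : nat :=
  #|[set A : {set G} | clique A & #|A| == s]|.

Definition graph_class (m n : nat) (G : sgraph) : Prop :=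
  [/\ connected_graph G, #|edges G| = m & #|G| = n].

Definition is_max (S : nat -> Prop) (v : nat) : Prop :=
  S v /\ forall k, S k -> k <= v.

(* The pair (r, t) = (r_{m,n}, t_{m,n}).  The identity is stated in int because
   m - n may be -1; r.-1 is an honest predecessor since r > 0. *)
Definition rt_params (m n r t : nat) : Prop :=
  [/\ 0 < r, 0 < t,
      (m%:Z - n%:Z = 'C(r.-1, 2)%:Z + t%:Z - 2%:Z)%R,
      n <= m -> 2 <= t <= r
    & m.+1 = n -> t = 1 /\ r = 1].

Lemma rt_params_exists (m n : nat) :
  n - 1 <= m -> 0 < n -> exists r t, rt_params m n r t.
Proof.
move=> hm hn.
have [nm|mn] := leqP n m; last first.
  exists 1, 1; split=> //; rewrite ?bin_small //; lia.
suff H d : exists r t, 2 <= t <= r /\ d + 2 = 'C(r.-1, 2) + t.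
  have [r [t [h1 h2]]] := H (m - n); exists r, t; split=> //; lia.
elim: d => [|d [r [t [h1 h2]]]]; first by exists 2, 2; rewrite bin_small.
have [tr|rt] := ltnP t r; first by exists r, t.+1; split; lia.
exists r.+1, 2; split; first lia.
case: r h1 h2 rt => [|r] h1 h2 rt; first lia.
by rewrite /= in h2 *; rewrite binS bin1; lia.
Qed.

Lemma rt_params_unique (m n r t r' t' : nat) :
  n - 1 <= m -> rt_params m n r t -> rt_params m n r' t' -> r = r' /\ t = t'.
Proof.
move=> hm [r0 t0 e h1 h2] [r0' t0' e' h1' h2'].
have [nm|mn] := leqP n m; last first.
  have emn : m.+1 = n by lia.
  by case: (h2 emn) (h2' emn) => -> -> [-> ->].
have {}h1 := h1 nm; have {}h1' := h1' nm.
have step a : 0 < a -> 'C(a, 2) = 'C(a.-1, 2) + a.-1.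
  by case: a => // a _; rewrite binS bin1.
have key a b : a < b -> 'C(a.-1, 2) + a.-1 <= 'C(b.-1, 2).
  move=> ab; case: a ab => [|a] ab; first by rewrite bin0n.
  by rewrite -step //; apply: leq_bin2l; lia.
have [lt|gt|eq] := ltngtP r r'.
- by have := key _ _ lt; lia.
- by have := key _ _ gt; lia.
by move: e e'; rewrite eq; lia.
Qed.

(* Main.v *)
Require Import Defs.
From mathcomp Require Import all_boot.
From mathcomp Require Import zify.

(** For adjacent vertices u and v, replacing N(v) by the union and N(u) by the
    intersection of the two neighbourhoods keeps the graph connected and the
    number of edges unchanged, and does not decrease the number of s-cliques.
    Repeating this with v fixed makes v adjacent to every other vertex; what
    remains is a graph with m - n + 1 = 'C(r - 1, 2) + (t - 1) edges, whose s-
    and (s-1)-cliques are bounded by the Kruskal-Katona theorem for graphs.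
    The latter follows by deleting a vertex of minimum degree d, which has
    d <= a when there are 'C(a, 2) + b edges, b <= a, because minimum degree d
    forces at least 'C(d + 1, 2) edges.  Equality holds
    for K_r, plus a vertex joined to t vertices of it, plus pendant vertices. *)

Set Implicit Arguments.
Unset Strict Implicit.
Unset Printing Implicit Defensive.

(** Convexity: the increment of ['C(x, k.+1)] in [x] is ['C(x, k)], which is monotone in [x]. *)
Lemma leq_bin_convex (b p q k : nat) :
  'C(b + p, k) + 'C(b + q, k) <= 'C(b + (p + q), k) + 'C(b, k).
Proof.
case: k => [|k]; first by rewrite !bin0.
elim: q => [|q IH]; first by rewrite !addn0.
rewrite !addnS !binS.
have := @leq_bin2l (b + q) (b + (p + q)) k; lia.
Qed.

(** * Counting cliques inside a vertex set *)

Section Cliques.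
Variable T : finType.
Implicit Types (e : rel T) (A B X : {set T}) (u v w : T) (s : nat).

Definition is_clique e X :=
  [forall x in X, forall y in X, (x != y) ==> e x y].

Lemma is_cliqueP e X :
  reflect {in X &, forall x y, x != y -> e x y} (is_clique e X).
Proof.
apply: (iffP forall_inP) => H.
  by move=> x y xX yX; move/forall_inP: (H x xX) => /(_ y yX) /implyP.
by move=> x xX; apply/forall_inP => y yX; apply/implyP; apply: H.
Qed.

(** Relativising to a subset [A] of a fixed type makes vertex deletion and restriction to a
    neighbourhood plain set operations. Size 2 counts edges, size 1 vertices. *)
Definition cliques e s A :=
  [set X : {set T} | [&& X \subset A, is_clique e X & #|X| == s]].

Definition ncl e s A := #|cliques e s A|.

Definition nbhd e v := [set w | e v w].

Lemma is_cliqueS e (X Y : {set T}) : X \subset Y -> is_clique e Y -> is_clique e X.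
Proof.
by move=> /subsetP sXY /is_cliqueP H; apply/is_cliqueP => x y /sXY ? /sXY; apply: H.
Qed.

Lemma eq_ncl e e' s A : {in A &, e =2 e'} -> ncl e s A = ncl e' s A.
Proof.
move=> E; apply: eq_card => X; rewrite !inE; case: (boolP (X \subset A)) => //=.
move=> /subsetP XA; congr andb.
by apply/is_cliqueP/is_cliqueP => H x y xX yX xy; have := H x y xX yX xy;
  rewrite E ?XA.
Qed.

Lemma ncl_le e s A : ncl e s A <= 'C(#|A|, s).
Proof.
rewrite -cards_draws; apply/subset_leq_card/subsetP => X.
by rewrite !inE => /and3P[-> _ ->].
Qed.

Lemma ncl_clique e s A : is_clique e A -> ncl e s A = 'C(#|A|, s).
Proof.
move=> cA; rewrite -cards_draws; apply: eq_card => X; rewrite !inE.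
by case: (boolP (X \subset A)) => //= XA; rewrite (is_cliqueS XA).
Qed.

Lemma ncl1 e A : ncl e 1 A = #|A|.
Proof.
rewrite -[RHS]bin1 -cards_draws; apply: eq_card => X; rewrite !inE.
case: (X \subset A) => //=; case: cards1P => [[x ->]|]; last by rewrite andbF.
by rewrite andbT; apply/is_cliqueP => y z /set1P-> /set1P->; rewrite eqxx.
Qed.

(** A clique inside both sets lies in [A :&: B], one inside either lies in [A :|: B]; the union may
    hold further cliques. *)
Lemma ncl_supermodular e s A B :
  ncl e s A + ncl e s B <= ncl e s (A :&: B) + ncl e s (A :|: B).
Proof.
rewrite /ncl -cardsUI addnC; apply: leq_add; apply/subset_leq_card/subsetP => X;
  rewrite !inE ?subsetI.
  by case/andP => /and3P[-> -> ->] /andP[->].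
by case/orP => /and3P[XA -> ->]; rewrite !andbT subsetU ?XA ?orbT.
Qed.

(** * Vertex deletion and the Kruskal-Katona bound *)

Section Deletion.
Variable e : rel T.
Hypotheses (esym : symmetric e) (eirr : irreflexive e).

(** Cliques are split by whether they contain [v]; those that do correspond, by removing [v], to
    cliques of its neighbourhood. *)
Lemma ncl_delete s A v : v \in A ->
  ncl e s.+1 A = ncl e s.+1 (A :\ v) + ncl e s (A :&: nbhd e v).
Proof.
move=> vA; rewrite /ncl -(cardsID [set X : {set T} | v \in X]) addnC.
congr (_ + _).
  by apply: eq_card => X; rewrite !inE subsetD1; case: (v \in X);
    rewrite /= ?andbF ?andbT.
have vN X : X \in cliques e s (A :&: nbhd e v) -> v \notin X.
  rewrite inE subsetI => /and3P[/andP[_ /subsetP XN] _ _].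
  by apply/negP => /XN; rewrite inE eirr.
rewrite -(@card_in_imset _ _ (setU [set v])
  (mem (cliques e s (A :&: nbhd e v)))); last first.
  by move=> X Y /vN nX /vN nY /(congr1 (fun Z => Z :\ v)); rewrite !setU1K.
apply: eq_card => X; apply/idP/imsetP => [|[Y HY ->]].
  rewrite !inE => /andP[/and3P[XA cX sX] vX]; exists (X :\ v); last by rewrite setD1K.
  rewrite inE (is_cliqueS (subsetDl _ _) cX) /= subsetI.
  move: sX; rewrite (cardsD1 v) vX eqSS => ->; rewrite andbT.
  rewrite (subset_trans (subsetDl _ _) XA) /=.
  apply/subsetP => x; rewrite !inE => /andP[xv xX].
  by move/is_cliqueP: cX; apply=> //; rewrite eq_sym.
have nY := vN _ HY; move: HY; rewrite !inE subsetI eqxx /= andbT.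
move=> /and3P[/andP[YA /subsetP YN] /is_cliqueP cY /eqP sY].
rewrite cardsU1 nY sY eqxx andbT subUset sub1set vA YA /=.
apply/is_cliqueP => x y /setU1P[->|xY] /setU1P[->|yY]; rewrite ?eqxx //.
- by have := YN _ yY; rewrite inE.
- by have := YN _ xY; rewrite inE esym.
- exact: cY.
Qed.

(** Induction on [d]: deleting one vertex loses at least its degree in edges and lowers every other
    degree by at most one. *)
Lemma min_degree_edges d A : A != set0 ->
  {in A, forall v, d <= #|A :&: nbhd e v|} -> 'C(d.+1, 2) <= ncl e 2 A.
Proof.
elim: d A => [|d IH] A /set0Pn[v vA] H; first by rewrite bin_small.
rewrite binS bin1 (ncl_delete 1 vA) ncl1.
apply: leq_add; last exact: H.
have : 0 < #|A :&: nbhd e v| by apply: leq_trans (H v vA).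
rewrite card_gt0 => /set0Pn[w]; rewrite !inE => /andP[wA vw].
have wv : w != v by apply/eqP => E; rewrite E eirr in vw.
apply: IH => [|x]; first by apply/set0Pn; exists w; rewrite !inE wv.
rewrite !inE => /andP[_ xA]; rewrite -ltnS (leq_trans (H x xA)) //.
rewrite (cardsD1 v) setIDAC; case: (v \in _); lia.
Qed.

(** Induction on [#|A|] with [a] and [b] varying; a vertex of degree [d] lies in at most
    ['C(d, s.+1)] cliques of size [s.+2]. *)
Lemma kruskal_katona_cliques s A a b : b <= a -> ncl e 2 A = 'C(a, 2) + b ->
  ncl e s.+2 A <= 'C(a, s.+2) + 'C(b, s.+1).
Proof.
have [k] := ubnP #|A|; elim: k => // k IH in A a b *; rewrite ltnS => leAk ba eA.
have [->|A0] := eqVneq A set0.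
  by apply: leq_trans (ncl_le _ _ _) _; rewrite cards0 bin0n.
have [v0 v0A] := set0Pn _ A0.
case: (@arg_minnP _ v0 (mem A) (fun v => #|A :&: nbhd e v|) v0A) => v.
rewrite inE => vA vmin.
have {vmin} := min_degree_edges A0 vmin.
have := ncl_delete 1 vA; have := ncl_delete s.+1 vA; rewrite ncl1 => -> eD.
have := ncl_le e s.+1 (A :&: nbhd e v).
move: eD; set d := #|_ :&: _| => eD Ld; rewrite binS bin1 => dmin.
have ltk : #|A :\ v| < k by move: leAk; rewrite (cardsD1 v A) vA; lia.
have [db|bd] := leqP d b.
  (* The deleted edges all come out of [b]; convexity from base 0 recombines [b - d] and [d] into
     [b]. *)
  have := IH _ a (b - d) ltk; have := leq_bin_convex 0 (b - d) d s.+1.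
  rewrite !add0n subnK // bin0n; lia.
have da : d < a by rewrite ltnNge; apply/negP => ad;
  have := leq_bin2l 2 ad; lia.
case: a ba eA da => // a ba eA; rewrite ltnS => da.
move: eA; rewrite binS bin1 => eA.
(* With [a] now the predecessor, ['C(a, 2) + (a + b - d)] edges remain and [a + b - d <= a]. The
   pair [a + b - d], [d] has the same sum as the more spread pair [a], [b], so convexity applies. *)
have := IH _ a (a + b - d) ltk; have := leq_bin_convex b (a - d) (d - b) s.+1.
rewrite binS; have -> : b + (a - d) = a + b - d by lia.
have -> : b + (d - b) = d by lia.
have -> : b + (a - d + (d - b)) = a by lia.
lia.
Qed.

End Deletion.

(** * Shifting neighbourhoods along an edge *)

(** Testing [v] before [u] keeps the edge [uv], which the intersection would lose; the guard
    [y != v] avoids a loop at [v], a neighbour of [u]. *)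
Definition shift e u v : rel T := fun x y =>
  if x == v then (y != v) && (e v y || e u y)
  else if y == v then e v x || e u x
  else if x == u then e v y && e u y
  else if y == u then e v x && e u x
  else e x y.

Section Shift.
Variables (e : rel T) (u v : T).
Hypotheses (esym : symmetric e) (eirr : irreflexive e) (evu : e v u).

Lemma shift_neq : (u == v) = false.
Proof. by apply/eqP => E; move: evu; rewrite E eirr. Qed.

Lemma shift_sym : symmetric (shift e u v).
Proof.
move=> x y; rewrite /shift.
case: (eqVneq x v) (eqVneq y v) => [_|_] [_|_] //=.
by case: (eqVneq x u) (eqVneq y u) => [xu|_] [yu|_] //=; rewrite ?xu ?yu // esym.
Qed.

Lemma shift_irrefl : irreflexive (shift e u v).
Proof.
move=> x; rewrite /shift; case: (eqVneq x v) => //= _.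
by case: (eqVneq x u) => [->|_]; rewrite eirr ?andbF.
Qed.

(** Only edges at [u] can vanish, and an edge [uy] is replaced by the path [u], [v], [y]. *)
Lemma shift_connect x y : connect e x y -> connect (shift e u v) x y.
Proof.
apply: connect_sub => {x y}.
suff H x y : e x y -> x != v -> y != v -> y != u -> connect (shift e u v) x y.
  have Hv y : e v y -> connect (shift e u v) v y.
    move=> vy; apply: connect1; rewrite /shift eqxx vy andbT.
    by apply/eqP => E; rewrite E eirr in vy.
  move=> x y xy.
  have cs : connect_sym (shift e u v) by apply: sym_connect_sym; apply: shift_sym.
  case: (eqVneq x v) xy => [->|xv] xy; first exact: Hv.
  case: (eqVneq y v) xy => [->|yv] xy; first by rewrite cs Hv // esym.
  case: (eqVneq y u) xy => [->|yu] xy; last exact: H.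
  case: (eqVneq x u) xy => [->|xu] xy; first by rewrite eirr in xy.
  by rewrite cs H // ?shift_neq // esym.
move=> xy xv yv yu; case: (eqVneq x u) xy => [->|xu] xy.
  apply: (@connect_trans _ _ v); apply: connect1.
    by rewrite /shift shift_neq eqxx evu.
  by rewrite /shift eqxx yv xy orbT.
by apply: connect1; rewrite /shift !ifN.
Qed.

Let P := nbhd e u :\ v.
Let Q := nbhd e v :\ u.

(** The four terms count cliques containing neither vertex, only [u], only [v], and both. *)
Lemma ncl_split s :
  ncl e s.+2 setT = ncl e s.+2 ([set: T] :\ v :\ u) + ncl e s.+1 P
                    + (ncl e s.+1 Q + ncl e s (P :&: Q)).
Proof.
rewrite (ncl_delete esym eirr _ (in_setT v)) setTI.
have uTv : u \in [set: T] :\ v by rewrite !inE shift_neq.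
have uNv : u \in nbhd e v by rewrite inE.
rewrite (ncl_delete esym eirr _ uTv) (ncl_delete esym eirr _ uNv).
congr (_ + ncl _ _ _ + (_ + ncl _ _ _)); apply/setP => x; rewrite !inE ?andbT //.
by case: (eqVneq x v) (eqVneq x u) => [->|_] [->|_]; rewrite ?eirr ?andbF // andbC.
Qed.

Lemma nbhd_shift_u : nbhd (shift e u v) u :\ v = P :&: Q.
Proof.
apply/setP => x; rewrite !inE /shift shift_neq eqxx.
case: (eqVneq x v) => //= _; rewrite andbC.
by case: (eqVneq x u) => [->|_]; rewrite ?eirr.
Qed.

Lemma nbhd_shift_v : nbhd (shift e u v) v :\ u = P :|: Q.
Proof.
apply/setP => x; rewrite !inE /shift eqxx.
case: (eqVneq x v) => [->|_] /=; first by rewrite eirr andbF.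
by case: (eqVneq x u) => [->|_] /=; rewrite ?eirr // orbC.
Qed.

Lemma shift_edge : shift e u v v u.
Proof. by rewrite /shift eqxx shift_neq evu. Qed.

End Shift.

Section ShiftCount.
Variables (e : rel T) (u v : T).
Hypotheses (esym : symmetric e) (eirr : irreflexive e) (evu : e v u).

Lemma ncl_shift_split s (P := nbhd e u :\ v) (Q := nbhd e v :\ u) :
  ncl (shift e u v) s.+2 setT =
    ncl e s.+2 ([set: T] :\ v :\ u) + ncl (shift e u v) s.+1 (P :&: Q)
    + (ncl (shift e u v) s.+1 (P :|: Q) + ncl (shift e u v) s (P :&: Q)).
Proof.
rewrite (@ncl_split _ u v); [|exact: shift_sym|exact: shift_irrefl|exact: shift_edge].
rewrite nbhd_shift_u // nbhd_shift_v //.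
have -> : (P :&: Q) :&: (P :|: Q) = P :&: Q.
  by apply/setIidPl; apply: subset_trans (subsetIl _ _) (subsetUl _ _).
congr (_ + _ + _); apply: eq_ncl => x y; rewrite !inE !andbT.
by move=> /andP[xu xv] /andP[yu yv]; rewrite /shift !ifN.
Qed.

(** The sets [P] and [Q] avoid [u] and [v], so adjacency inside them is unchanged, and
    supermodularity compares the split counts. *)
Lemma ncl_shift s : ncl e s.+2 setT <= ncl (shift e u v) s.+2 setT.
Proof.
set P := nbhd e u :\ v; set Q := nbhd e v :\ u.
have E k A : A \subset P :|: Q -> ncl (shift e u v) k A = ncl e k A.
  move=> /subsetP sA; apply: eq_ncl.
  suff nA x : x \in A -> (x != v) && (x != u).
    by move=> x y /nA/andP[xv xu] /nA/andP[yv yu]; rewrite /shift !ifN.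
  by move=> /sA; rewrite !inE; case: (eqVneq x v) (eqVneq x u) => [->|_] [->|_];
    rewrite ?eirr ?andbF.
have sI : P :&: Q \subset P :|: Q by apply: subset_trans (subsetIl _ _) (subsetUl _ _).
rewrite ncl_shift_split (ncl_split esym eirr evu) -/P -/Q !E //.
have := ncl_supermodular e s.+1 P Q; lia.
Qed.

(** For edges the split involves only cardinalities and the single empty clique, so supermodularity
    becomes an equality. *)
Lemma edges_shift : ncl (shift e u v) 2 setT = ncl e 2 setT.
Proof.
set P := nbhd e u :\ v; set Q := nbhd e v :\ u.
rewrite ncl_shift_split (ncl_split esym eirr evu) -/P -/Q !ncl1.
have n0 f : ncl f 0 (P :&: Q) = 1.
  have c0 : is_clique f set0 by apply/is_cliqueP => x y; rewrite inE.
  rewrite -[RHS](bin0 #|P :&: Q|) -cards_draws; apply: eq_card => X; rewrite !inE.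
  by case: (X \subset _); rewrite //= cards_eq0; case: eqVneq => [->|]; rewrite ?c0 ?andbF.
rewrite !n0; have := cardsUI P Q; lia.
Qed.

End ShiftCount.

(** * Reduction to a dominating vertex and the upper bound *)

Definition dominating e v := forall w, w != v -> e v w.

(** Induction on the number of non-neighbours of [v]: if [w] is at distance two from [v] through
    [u], the shift makes [w] a neighbour of [v] and loses none. *)
Lemma exists_dominating e v : symmetric e -> irreflexive e ->
    (forall x y, connect e x y) ->
  exists e', [/\ symmetric e', irreflexive e', dominating e' v,
    ncl e' 2 setT = ncl e 2 setT &
    forall s, ncl e s.+2 setT <= ncl e' s.+2 setT].
Proof.
have [k] := ubnP #|~: nbhd e v|; elim: k => // k IH in e *.
rewrite ltnS => lek esym eirr ec.
case: (boolP [exists u, exists w, [&& e v u, e u w, w != v & ~~ e v w]]); last first.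
  move=> H; exists e; split=> // w wv.
  (* With no vertex at distance two, the closed neighbourhood of [v] is a union of components, hence
     everything. *)
  have cl : closed e (v |: nbhd e v).
    apply: intro_closed; first exact: sym_connect_sym.
    move=> x y xy; rewrite !inE; case: (eqVneq y v) => //= yv.
    case/orP => [/eqP E|vx]; first by rewrite -E.
    apply: contraNT H => vy; apply/existsP; exists x; apply/existsP; exists y.
    by rewrite vx xy yv vy.
  have := closed_connect cl (ec v w); rewrite !inE eqxx (negPf wv) /=.
  by move=> <-.
case/existsP => u /existsP[w /and4P[vu uw wv nvw]].
have [| | | |e' [S I D E L]] := IH (shift e u v).
- apply: leq_trans lek; apply: proper_card.
  apply/properP; split.
    apply/subsetP => x; rewrite !inE; apply: contra => vx.
    rewrite /shift eqxx vx andbT.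
    by apply/eqP => E; rewrite E eirr in vx.
  by exists w; rewrite !inE // /shift eqxx wv uw orbT.
- exact: shift_sym.
- exact: shift_irrefl.
- by move=> x y; apply: shift_connect.
exists e'; split=> //; first by rewrite E edges_shift.
by move=> s; apply: leq_trans (L s); apply: ncl_shift.
Qed.

(** Deleting a dominating [v] removes [#|T|.-1] edges; the bounds for the two clique sizes in the
    rest add up by Pascal's rule. *)
Lemma connected_ncl_bound e s a b : symmetric e -> irreflexive e ->
    (forall x y, connect e x y) -> 0 < #|T| ->
    b <= a -> ncl e 2 setT = 'C(a, 2) + b + #|T|.-1 ->
  ncl e s.+3 setT <= 'C(a.+1, s.+3) + 'C(b.+1, s.+2).
Proof.
move=> esym eirr ec /card_gt0P[v _] ba.
have [e' [S I D <- L]] := exists_dominating v esym eirr ec.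
move=> E2; apply: leq_trans (L _) _.
have N : [set: T] :&: nbhd e' v = [set: T] :\ v.
  apply/setP => x; rewrite !inE andbT; case: (eqVneq x v) => [->|/D ->] //.
  by rewrite I.
have cT : #|[set: T] :\ v| = #|T|.-1.
  by rewrite cardsDS ?subsetT // cardsT cards1 subn1.
move: E2; rewrite !(ncl_delete S I _ (in_setT v)) N ncl1 cT => E2.
have {}E2 : ncl e' 2 ([set: T] :\ v) = 'C(a, 2) + b by lia.
have := kruskal_katona_cliques S I s.+1 ba E2.
have := kruskal_katona_cliques S I s ba E2.
rewrite !binS; lia.
Qed.

End Cliques.

(** * Translation to [sgraph] *)

Lemma edges_ncl (G : sgraph) : #|edges G| = ncl (@sadj G) 2 setT.
Proof.
apply: eq_card => X; rewrite !inE subsetT /=; apply/existsP/andP.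
  case=> x /existsP[y /andP[xy /eqP->]].
  have nxy : x != y by apply/eqP => E; rewrite E sadj_irrefl in xy.
  rewrite cards2 nxy; split=> //; apply/is_cliqueP => a b.
  by move=> /set2P[]-> /set2P[]->; rewrite ?eqxx // sadj_sym.
case=> /is_cliqueP cX /cards2P[x [y [xy E]]].
exists x; apply/existsP; exists y; rewrite E eqxx andbT.
by apply: cX => //; rewrite E !inE eqxx ?orbT.
Qed.

Lemma num_cliques_ncl (G : sgraph) s : num_cliques s G = ncl (@sadj G) s setT.
Proof. by apply: eq_card => X; rewrite !inE subsetT. Qed.

(** * The extremal graph *)

Section Extremal.
Variables (n r t : nat).
Hypotheses (r0 : 0 < r) (t0 : 0 < t) (tr : t <= r) (rn : r < n).

(** For [i < j]; the threshold is the number of earlier neighbours of [j]: all of them in the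
    clique, [t] at vertex [r], and only vertex 0 for pendant vertices. *)
Definition low_adj (i j : nat) := i < (if j < r then j else if j == r then t else 1).

Definition extremal_adj : rel 'I_n := fun i j =>
  (i < j) && low_adj i j || (j < i) && low_adj j i.

Lemma extremal_sym : symmetric extremal_adj.
Proof. by move=> i j; rewrite /extremal_adj orbC. Qed.

Lemma extremal_irrefl : irreflexive extremal_adj.
Proof. by move=> i; rewrite /extremal_adj ltnn. Qed.

Definition extremal_graph := SGraph extremal_sym extremal_irrefl.

Let seg k := [set i : 'I_n | i < k].

Lemma card_seg k : k <= n -> #|seg k| = k.
Proof.
by move=> kn; rewrite -sum1dep_card (big_ord_narrow kn) sum1_card card_ord.
Qed.

Lemma extremal_connected : connected_graph extremal_graph.
Proof.
have n0 : 0 < n by lia.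
suff H (x : 'I_n) : connect extremal_adj (Ordinal n0) x.
  move=> x y; apply: (@connect_trans _ _ (Ordinal n0)); last exact: H.
  by rewrite (sym_connect_sym extremal_sym); apply: H.
have [->|x0] := eqVneq x (Ordinal n0); first exact: connect0.
have {x0} xp : 0 < x by rewrite lt0n.
apply: connect1; rewrite /= /extremal_adj /low_adj /= xp orbF.
by case: (x < r) => //; case: (x == r :> nat); rewrite ?t0.
Qed.

Lemma seg_clique k : k <= r -> is_clique extremal_adj (seg k).
Proof.
move=> kr; apply/is_cliqueP => x y; rewrite !inE => xk yk xy.
have /eqP nxy : x != y :> nat by [].
rewrite /extremal_adj /low_adj !ifT; lia.
Qed.

Lemma ncl_seg s k : k <= r -> ncl extremal_adj s (seg k) = 'C(k, s).
Proof. by move=> kr; rewrite ncl_clique ?seg_clique // card_seg //; lia. Qed.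

(** The earlier neighbours of [k] form [seg c], a clique because [c <= r]. *)
Lemma ncl_segS s k c : k < n -> c <= k -> c <= r ->
    (forall i, i < k -> low_adj i k = (i < c)) ->
  ncl extremal_adj s.+1 (seg k.+1) = ncl extremal_adj s.+1 (seg k) + 'C(c, s).
Proof.
move=> kn ck cr H; have kS : Ordinal kn \in seg k.+1 by rewrite inE.
rewrite (ncl_delete extremal_sym extremal_irrefl _ kS) -(ncl_seg s cr).
congr (ncl extremal_adj _ _ + ncl extremal_adj _ _);
  apply/setP => x; rewrite !inE ?ltnS.
  by rewrite -val_eqE /= ltn_neqAle.
rewrite /extremal_adj /=; have [xk|kx|->] := ltngtP x k.
- by rewrite H.
- by symmetry; apply/negbTE; lia.
- by symmetry; apply/negbTE; lia.
Qed.

(** The factor ['C(1, s.+1)] is 1 for edges and 0 for larger cliques, so one formula serves both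
    counts. *)
Lemma ncl_extremal s :
  ncl extremal_adj s.+2 setT = 'C(r, s.+2) + 'C(t, s.+1) + (n - r.+1) * 'C(1, s.+1).
Proof.
have H d : r.+1 + d <= n ->
    ncl extremal_adj s.+2 (seg (r.+1 + d))
    = 'C(r, s.+2) + 'C(t, s.+1) + d * 'C(1, s.+1).
  elim: d => [|d IH] dn.
    rewrite addn0 mul0n addn0 (@ncl_segS _ _ t) ?ncl_seg // => i ir.
    by rewrite /low_adj ltnn eqxx.
  rewrite addnS (@ncl_segS _ _ 1) ?IH //; try lia.
  by move=> i ir; rewrite /low_adj !ifF //; lia.
rewrite -H; last by lia.
congr ncl; apply/setP => x; rewrite !inE; have := ltn_ord x; lia.
Qed.

End Extremal.

Theorem theorem2p1 (m n s r t : nat)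
    (hm : 0 < m) (hn : 0 < n) (hs : 3 <= s)
    (hmn : n - 1 <= m <= 'C(n, 2))
    (hrt : rt_params m n r t) :
  is_max (fun k => exists G : sgraph, graph_class m n G /\ num_cliques s G = k)
         ('C(r, s) + 'C(t, s - 1)).
Proof.
case: hrt => r0 t0 E h1 h2.
case: s hs => [|[|[|s]]] // _; rewrite subn1 /=.
have {h1 h2} [tr h] : t <= r /\ (2 <= t \/ r = 1).
  have [nm|mn] := leqP n m; last first.
    by have [|-> ->] := h2; [lia|split; last right].
  by have /andP[? ?] := h1 nm; split; last left.
have En : m.+2 = 'C(r.-1, 2) + t + n by lia.
have [rp Er] : exists rp, r = rp.+1 by exists r.-1; lia.
have [tp Et] : exists tp, t = tp.+1 by exists t.-1; lia.
subst r t; rewrite /= in E En.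
(* This is the edge count required by the upper bound, with [a = r - 1] and [b = t - 1]. *)
have Em : m = 'C(rp, 2) + tp + n.-1 by lia.
split; last first.
  move=> k [G [[Gc Ge Gn] <-]]; rewrite num_cliques_ncl.
  apply: connected_ncl_bound => //.
  - exact: sadj_sym.
  - exact: sadj_irrefl.
  - by rewrite Gn.
  - by rewrite -edges_ncl Ge Gn.
(* If [n <= r], then [m] is at least ['C(n, 2) + t - 1], too large when [2 <= t]; when [r = 1] this
   forces [n = 1] and [m = 0], against [hm]. *)
have rn : rp.+1 < n.
  rewrite ltnNge; apply/negP => nr.
  case: n hn hmn {E En} Em h nr => // n _ /andP[_]; rewrite binS bin1 ltnS /=.
  move=> hmn Em h nr; have := leq_bin2l 2 (nr : n <= rp).
  case: h => [|[rp0]]; first by lia.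
  by move: Em; rewrite rp0 bin0n; lia.
exists (extremal_graph n rp.+1 tp.+1); split.
  split; first exact: extremal_connected.
    rewrite edges_ncl ncl_extremal // Em !bin1 muln1 binS bin1; lia.
  by rewrite card_ord.
by rewrite num_cliques_ncl ncl_extremal // (@bin_small 1) // muln0 addn0.
Qed.
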